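(* If $G$ is a smooth graph, $W\subseteq V(G)$, and the induced subgraph $G[W]$ is an isometric subgraph of $G$, then $G[W]$ is smooth.
   Context: Graphs are simple and undirected; $d$ denotes the shortest path distance of a connected graph $G$. Intervals: $I[u,v]=\{w\in V(G): d(u,w)+d(w,v)=d(u,v)\}$; $N(u)=\{w: d(u,w)=1\}$; the step system (step function) of $G$ is $S(u,v)=I[u,v]\cap N(u)$. A connected graph $G$ is smooth if for all vertices $u,v,w,x,y$: $v\in S(u,w)$, $v\in S(u,y)$ and $x\in S(w,y)$ imply $v\in S(u,x)$. For $W\subseteq V(G)$, $G[W]$ is the subgraph induced by $W$; it is an isometric subgraph of $G$ if $d_{G[W]}(u,v)=d_G(u,v)$ for all $u,v\in W$. *)

(* Defs.v *)
From mathcomp Require Import all_boot.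
From mathcomp Require Import boolp classical_sets.

Set Implicit Arguments.
Unset Strict Implicit.
Unset Printing Implicit Defensive.

Local Open Scope classical_set_scope.

(* The vertex set is an arbitrary type with equality: graphs may be infinite,
   and may be empty. *)
Record sgraph := SGraph {
  vertex :> eqType;
  adj : rel vertex;
  adj_sym : symmetric adj;
  adj_irrefl : irreflexive adj
}.

(* [u :: p] is a path (without repeated vertices) from u to v; its length, the
   number of edges, is [size p]. *)
Definition path_between (G : sgraph) (u v : G) (p : seq G) : bool :=
  [&& path (@adj G) u p, last u p == v & uniq (u :: p)].

Definition connected (G : sgraph) : Prop :=
  forall u v : G, exists p, path_between u v p.

Definition path_length (G : sgraph) (u v : G) : pred nat :=
  fun n => `[< exists2 p, path_between u v p & size p = n >].

(* [None] stands for an infinite distance: no path joins u and v. *)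
Definition dist (G : sgraph) (u v : G) : option nat :=
  if pselect (exists n, path_length u v n) is left ex
  then Some (ex_minn ex) else None.

Definition dist_add (a b : option nat) : option nat :=
  if a is Some m then if b is Some n then Some (m + n) else None else None.

Definition interval (G : sgraph) (u v : G) : set G :=
  [set w | dist_add (dist u w) (dist w v) = dist u v].

Definition neighbours (G : sgraph) (u : G) : set G :=
  [set w | dist u w = Some 1].

Definition step (G : sgraph) (u v : G) : set G :=
  interval u v `&` neighbours u.

Definition smooth (G : sgraph) : Prop :=
  connected G /\
  forall u v w x y : G,
    v \in step u w -> v \in step u y -> x \in step w y -> v \in step u x.

Section Induced.
Variables (G : sgraph) (W : {pred G}).

Definition induced_adj : rel {x : G | x \in W} := relpre val (@adj G).

Lemma induced_sym : symmetric induced_adj.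
Proof. by move=> x y; apply: adj_sym. Qed.

Lemma induced_irrefl : irreflexive induced_adj.
Proof. by move=> x; apply: adj_irrefl. Qed.

Definition induced : sgraph := SGraph induced_sym induced_irrefl.

Definition isometric : Prop :=
  forall u v : induced, dist u v = dist (val u) (val v).

End Induced.

(* Main.v *)
Require Import Defs.
From mathcomp Require Import all_boot.
From mathcomp Require Import boolp classical_sets.

(** Intervals, neighbourhoods, the step function and connectedness are all
    determined by the distance function alone.  An isometric subgraph inherits
    the distances of G, so its step function is the restriction of that of G
    ([step_induced]) and it is connected ([distP] reads connectedness off the
    finiteness of distances).  The smoothness condition is a universally
    quantified implication between memberships in step sets, hence it passes
    from all vertices of G to those of W. *)

Lemma distP (G : sgraph) (u v : G) :
  (exists p, path_between u v p) <-> dist u v <> None.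
Proof.
rewrite /dist; case: pselect => [ex|nex]; split=> //.
  by case: ex => n /asboolP[p uv_p _] _; exists p.
by case=> p uv_p _; apply: nex; exists (size p); apply/asboolP; exists p.
Qed.

Lemma connected_induced {G : sgraph} {W : {pred G}} :
  connected G -> isometric W -> connected (induced W).
Proof. by move=> conG isoW u v; apply/distP; rewrite isoW; apply/distP. Qed.

Lemma step_induced {G : sgraph} {W : {pred G}} (u v x : induced W) :
  isometric W -> (x \in step u v) = (val x \in step (val u) (val v)).
Proof.
by move=> isoW; apply/idP/idP; rewrite !in_setE /step /interval /neighbours /=
  !isoW.
Qed.

Theorem mainTheorem6 (G : sgraph) (W : {pred G}) :
  smooth G -> isometric W -> smooth (induced W).
Proof.
move=> [conG smoothG] isoW; split; first exact: connected_induced.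
by move=> u v w x y; rewrite !step_induced //; apply: smoothG.
Qed.
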